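(* Let $q_1,\dots,q_{n+1}$ be probability densities, $q=[q_1,\dots,q_{n+1}]^T$, and let $$\mathrm{MG}(q)=\Big\{\sum_{i=1}^{n+1}\theta_iq_i:\ \theta_i\ge0,\ \sum_{i=1}^{n+1}\theta_i=1\Big\}.$$ 1. If all $q_i$ belong to the same maximal exponential family $\mathcal E(p)$, then $\mathrm{MG}(q)\subset\mathcal E(p)$. In particular, one can choose $p\in\mathrm{MG}(q)$. 2. In such a case, let $V_p^1=\{U\in B_p:\ E_{q_j}[U]=0,\ j=1,\dots,n+1\}$. Then $V_p^1$ is closed in $B_p$ and $\mathrm{MG}(q)\subset\mathrm{MF}(V_p^1)$. 3. Suppose moreover that $p\in\mathrm{MG}(q)$ and that, for real $\alpha_1,\dots,\alpha_{n+1}$ with $\sum_{i=1}^{n+1}\alpha_i=1$, the function $\hat q=\sum_{i=1}^{n+1}\alpha_iq_i$ is a positive density only if $\alpha_i\ge0$ for all $i=1,\dots,n+1$. Then $\mathrm{MG}(q)=\mathrm{MF}(V_p^1)$.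
   Context: Fix a measure space with reference measure $\mu$. Let $\mathcal P_>$ be the set of strictly positive ($\mu$-a.e.) probability densities with respect to $\mu$; $E_p$ is expectation under $p\cdot\mu$. For $p\in\mathcal P_>$ and the Young function $\Phi(x)=\cosh x-1$, $L^\Phi(p)$ is the Orlicz space of random variables $U$ with $E_p[\Phi(\alpha U)]<\infty$ for some $\alpha>0$, with its Orlicz norm, and $B_p=\{U\in L^\Phi(p):E_p[U]=0\}$. On $B_p$ let $K_p(U)=\log E_p[e^U]$, and let $\mathcal S_p$ be the interior of $\{U\in B_p:K_p(U)<\infty\}$. The maximal exponential family at $p$ is $$\mathcal E(p)=\{e^{U-K_p(U)}\cdot p:\ U\in\mathcal S_p\}.$$ Known facts: for $p,r\in\mathcal P_>$, $r\in\mathcal E(p)$ iff $\mathcal E(r)=\mathcal E(p)$, iff $L^\Phi(p)=L^\Phi(r)$ with equivalent norms, iff there is $\varepsilon>0$ with $r/p\in L^{1+\varepsilon}(p)$ and $p/r\in L^{1+\varepsilon}(r)$. For a closed subspace $V_p\subset B_p$, the mixture-closed family of $V_p$ is $$\mathrm{MF}(V_p)=\{r\in\mathcal E(p):\ E_r[U]=0\ \text{for all }U\in V_p\}.$$ *)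

(* Defs.v *)
From HB Require Import structures.
From mathcomp Require Import all_boot all_order all_algebra.
From mathcomp Require Import all_classical all_reals all_analysis.
From mathcomp Require Import measurable_realfun hoelder.

Set Implicit Arguments.
Unset Strict Implicit.
Unset Printing Implicit Defensive.

Import Order.TTheory GRing.Theory Num.Theory.
Import numFieldNormedType.Exports.

Local Open Scope classical_set_scope.
Local Open Scope ring_scope.

(* Densities and random variables are represented by measurable functions, not
   by their mu-a.e. classes. The sets maxexp, mixture and mixture_closed below
   are therefore made closed under mu-a.e. equality, so that an inclusion or an
   equality between them is the one between the sets of classes. *)
Section maximal_exponential_families.
Context (d : measure_display) (T : measurableType d) (R : realType).
Variable mu : {measure set T -> \bar R}.
Implicit Types (p r U W : {mfun T >-> R}) (V : set {mfun T >-> R}).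

Definition density : set {mfun T >-> R} :=
  [set p | {ae mu, forall x, 0 <= p x} /\ (\int[mu]_x (p x)%:E = 1)%E].

Definition pos_density : set {mfun T >-> R} :=
  [set p | density p /\ {ae mu, forall x, 0 < p x}].

(* In \bar R, +oo - +oo = -oo, so that expect p f = 0 only when f * p is
   integrable. *)
Definition expect p (f : T -> R) : \bar R := (\int[mu]_x (f x * p x)%:E)%E.

Definition Phi (x : R) : R := (expR x + expR (- x)) / 2 - 1.

Definition orlicz p : set {mfun T >-> R} :=
  [set U | exists2 a : R, 0 < a & (expect p (fun x => Phi (a * U x)%R) < +oo)%E].

(* Luxemburg gauge of the unit ball E_p[Phi(U)] <= 1; for a density p it is
   finite exactly on orlicz p. *)
Definition orlicz_norm p U : \bar R :=
  ereal_inf [set k%:E | k in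
    [set k : R | 0 < k /\ (expect p (fun x => Phi (k^-1 * U x)%R) <= 1)%E]].

Definition centered p : set {mfun T >-> R} :=
  [set U | orlicz p U /\ expect p U = 0%E].

Definition cumulant p U : \bar R := lne (expect p (fun x => expR (U x))).

Definition interior_in_centered p V : set {mfun T >-> R} :=
  [set U | [/\ centered p U, V U &
    exists2 e : R, 0 < e & forall W, centered p W ->
      (orlicz_norm p (W - U)%R < e%:E)%E -> V W]].

Definition closed_in_centered p V : Prop :=
  V `<=` centered p /\
  forall U, centered p U ->
    (forall e : R, 0 < e -> exists2 W, V W & (orlicz_norm p (W - U)%R < e%:E)%E) ->
    V U.

Definition cumulant_domain p : set {mfun T >-> R} :=
  interior_in_centered p
    [set U | centered p U /\ (cumulant p U < +oo)%E].

Definition maxexp p : set {mfun T >-> R} :=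
  [set r | exists2 U, cumulant_domain p U &
    r = (fun x => expR (U x - fine (cumulant p U)) * p x) %[ae mu]].

Definition mixture_closed p V : set {mfun T >-> R} :=
  [set r | maxexp p r /\ forall U, V U -> expect r U = 0%E].

Definition linear_subspace V : Prop :=
  V 0 /\ forall (a : R) U W, V U -> V W -> V (a *: U + W).

Definition mixture (n : nat) (q : 'I_n.+1 -> {mfun T >-> R}) :
    set {mfun T >-> R} :=
  [set r | exists theta : 'I_n.+1 -> R,
    [/\ forall i, 0 <= theta i, \sum_i theta i = 1 &
        r = (\sum_i theta i *: q i : {mfun T >-> R}) %[ae mu]]].

Definition annihilator1 p (n : nat) (q : 'I_n.+1 -> {mfun T >-> R}) :
    set {mfun T >-> R} :=
  [set U | centered p U /\ forall j, expect (q j) U = 0%E].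

End maximal_exponential_families.

(* Main.v *)
Require Import Defs.
From HB Require Import structures.
From mathcomp Require Import all_boot all_order all_algebra.
From mathcomp Require Import all_classical all_reals all_analysis.
From mathcomp Require Import measurable_realfun hoelder.
From mathcomp Require Import ring lra.

Import Order.TTheory GRing.Theory Num.Theory.
Import numFieldNormedType.Exports.

Local Open Scope classical_set_scope.
Local Open Scope ring_scope.

(** Everything rests on a description of the maximal exponential family at [p]
that no longer mentions the Orlicz norm. Write [L = ln r - ln p]. A positive
density [r] belongs to [maxexp mu p] if and only if the moment
[s |-> E_p[exp (s L)]], that is [s |-> int p^(1-s) r^s], is finite at some
[- e < 0] and at some [1 + e > 1] ([maxexp_linked], [linked_maxexp]). In one
direction, [r = exp (U - K_p U) p] with [U] interior, so that [(1 + t) U] still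
has a finite cumulant for small [t > 0], while [exp (- a U)] is integrable
because [U] is in the Orlicz space. In the other direction [U = L - E_p[L]]
works, and all [W] close to [U] have a finite cumulant by Hoelder's inequality.

In this form the three assertions become elementary.

The moment condition is symmetric under [s |-> 1 - s], and it is transitive by
Hoelder's inequality; hence the families at two points of the same family
coincide ([maxexp_eq]). A mixture lies pointwise between the smallest and the
largest of its components, so each of its moments is at most the sum of theirs
([moment_finite_mixture]); hence mixtures stay in the family.

For [r] in the family, [U |-> E_r[U]] is continuous on the Orlicz space of [p]
([linked_expect_bound]), so that the common kernel of the [E_{q_j}] is closed
([expect_closed]). Mixtures vanish on this kernel by linearity.

Conversely let [E_r] vanish on this kernel. Bounded functions that are killed
by all [E_{q_j}] belong to it, because [p] is itself a mixture of the [q_j].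
A linear functional that vanishes on the common zeros of finitely many others
is a combination of them ([functional_span]), so
[E_r = sum_j alpha_j E_{q_j}] on bounded functions. Indicators give
[r = sum_j alpha_j q_j] almost everywhere, the constant [1] gives
[sum_j alpha_j = 1], and the last hypothesis makes the [alpha_j] nonnegative.

Hoelder's inequality is only ever needed up to a constant, and in that form it
is the pointwise bound [expR_conv_le]. *)

(** * Elementary inequalities for the exponential and for cosh - 1 *)

Section elementary.
Context {R : realType}.
Implicit Types a b s t x : R.

(** A convex combination is at most the larger of its two terms. Integrated,
this replaces Hoelder's inequality wherever only finiteness matters. *)
Lemma expR_conv_le s a b : 0 <= s <= 1 ->
  expR (s * a + (1 - s) * b) <= expR a + expR b.
Proof.
move=> /andP[s0 s1]; have [ab|ba] := leP a b.
  apply: (@le_trans _ _ (expR b)); last by rewrite lerDr expR_ge0.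
  rewrite ler_expR; nra.
apply: (@le_trans _ _ (expR a)); last by rewrite lerDl expR_ge0.
rewrite ler_expR; nra.
Qed.

Lemma expR_norm_le x : expR `|x| <= 2 * Phi x + 2.
Proof.
rewrite /Phi mulrBr mulrCA divff// !mulr1 subrK.
by have [x0|x0] := leP 0 x; rewrite ?(ger0_norm x0) ?(ltr0_norm x0)
  ?lerDl ?lerDr expR_ge0.
Qed.

Lemma Phi_le x : Phi x <= expR `|x|.
Proof.
have h : expR x <= expR `|x| by rewrite ler_expR ler_norm.
have h' : expR (- x) <= expR `|x| by rewrite ler_expR -normrN ler_norm.
rewrite /Phi; lra.
Qed.

Lemma Phi_ge0 x : 0 <= Phi x.
Proof.
rewrite /Phi; have := expR_ge1Dx x; have := expR_ge1Dx (- x); lra.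
Qed.

(** Convexity of [Phi] together with [Phi 0 = 0]; this is what makes the gauge
of [t *: U] tend to [0] with [t]. *)
Lemma Phi_scale t x : 0 <= t <= 1 -> Phi (t * x) <= t * Phi x.
Proof.
move=> t01.
have H y : expR (t * y) <= t * expR y + (1 - t).
  have := convex_expR (Itv01 (proj1 (andP t01)) (proj2 (andP t01))) y 0.
  by rewrite !convRE /= expR0 mulr0 addr0 mulr1.
have := H x; have := H (- x); rewrite /Phi mulrN; lra.
Qed.

Lemma measurable_Phi : measurable_fun setT (@Phi R).
Proof.
apply: measurable_funB => //; apply: measurable_funM => //.
by apply: measurable_funD => //; exact: measurableT_comp.
Qed.

Lemma expR_norm_sum (e y : R) :
  expR (e * `|y|) <= expR (- e * y) + expR (e * y).
Proof.
have [y0|y0] := leP 0 y.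
  by rewrite (ger0_norm y0) lerDr expR_ge0.
by rewrite (ltr0_norm y0) mulrN mulNr lerDl expR_ge0.
Qed.

End elementary.

(** * Functionals vanishing on a common kernel, and convex combinations *)

Definition lin_on {K : fieldType} {X : lmodType K} (B : set X) (f : X -> K) :=
  forall a x y, B x -> B y -> f (a *: x + y) = a * f x + f y.

(** Induction on the number of functionals. If the first one takes a nonzero
value at some [z], the projection [t] along [z] onto its kernel reduces the
claim to the remaining functionals composed with [t]; otherwise it can be
dropped. The subspace is a mere predicate [B], which spares a subtype for
bounded functions. *)
Lemma functional_span {K : fieldType} {X : lmodType K} (B : set X) (n : nat)
    (f : 'I_n -> X -> K) (g : X -> K) :
  (forall a x y, B x -> B y -> B (a *: x + y)) ->
  (forall i, lin_on B (f i)) -> lin_on B g ->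
  (forall x, B x -> (forall i, f i x = 0) -> g x = 0) ->
  exists alpha : 'I_n -> K, forall x, B x -> g x = \sum_i alpha i * f i x.
Proof.
move=> BP; elim: n f g => [|n IH] f g fl gl fg.
  by exists (fun=> 0) => x Bx; rewrite big_ord0 fg// => -[].
have [[z [Bz fz]]|f0] := pselect (exists z, B z /\ f ord0 z != 0); last first.
  have f0' x : B x -> f ord0 x = 0.
    by move=> Bx; apply: contrapT => /eqP fx; apply: f0; exists x.
  have [|b bE] := IH (f \o lift ord0) g (fun i => fl _) gl.
    move=> x Bx fx; apply: fg => // i.
    by have [j ->|->] := unliftP ord0 i; [exact: fx|exact: f0'].
  exists (fun i => if unlift ord0 i is Some j then b j else 0) => x Bx.
  rewrite big_ord_recl f0'// mulr0 add0r bE//.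
  by apply: eq_bigr => i _; rewrite liftK.
pose t x := - (f ord0 x / f ord0 z) *: z + x.
have Bt x : B x -> B (t x) by move=> Bx; exact: BP.
have tl a x y : B x -> B y -> t (a *: x + y) = a *: t x + t y.
  move=> Bx By; rewrite /t fl// mulrDl opprD scalerDl scalerDr scalerA.
  rewrite -mulrA mulrN !addrA; congr (_ + _).
  by rewrite -!addrA; congr (_ + _); rewrite addrC.
have ft i x : B x -> f i (t x) = - (f ord0 x / f ord0 z) * f i z + f i x.
  by move=> Bx; rewrite fl.
have gt x : B x -> g (t x) = - (f ord0 x / f ord0 z) * g z + g x.
  by move=> Bx; rewrite gl.
have f0t x : B x -> f ord0 (t x) = 0.
  by move=> Bx; rewrite ft// mulNr divfK// addNr.
have [||x Bx fx|b bE] := IH (fun i => f (lift ord0 i) \o t) (g \o t).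
- by move=> i a x y Bx By /=; rewrite tl// fl//; exact: Bt.
- by move=> a x y Bx By /=; rewrite tl// gl//; exact: Bt.
- apply: fg; first exact: Bt.
  by move=> i; have [j ->|->] := unliftP ord0 i; [exact: fx|exact: f0t].
(* The coefficient of the first functional is forced by evaluation at [z]. *)
pose a0 := (g z - \sum_i b i * f (lift ord0 i) z) / f ord0 z.
exists (fun i => if unlift ord0 i is Some j then b j else a0) => x Bx.
rewrite big_ord_recl unlift_none.
under eq_bigr do rewrite liftK.
have := bE x Bx; rewrite /= gt//.
under eq_bigr do rewrite ft// mulrDr mulrCA.
rewrite big_split/= -mulr_sumr /a0.
move: (\sum_i b i * f (lift ord0 i) z) (\sum_i _) => s1 s2.
move=> /(canRL (addKr _)) ->.
by field.
Qed.

Lemma convex_between {R : realType} (n : nat) (th y : 'I_n.+1 -> R) :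
  (forall i, 0 <= th i) -> \sum_i th i = 1 ->
  (exists i, y i <= \sum_k th k * y k) /\ (exists j, \sum_k th k * y k <= y j).
Proof.
move=> th0 th1; split.
  have [i _ iP] := @arg_minP _ R _ ord0 xpredT y isT; exists i.
  rewrite -[leLHS]mul1r -th1 mulr_suml ler_sum// => k _.
  by rewrite ler_wpM2l//; exact: iP.
have [i _ iP] := @arg_maxP _ R _ ord0 xpredT y isT; exists i.
rewrite -[leRHS]mul1r -th1 mulr_suml ler_sum// => k _.
by rewrite ler_wpM2l//; exact: iP.
Qed.

(** * Integrability and expectation with respect to a density *)

Section densities.
Context {d : measure_display} {T : measurableType d} {R : realType}.
Variable mu : {measure set T -> \bar R}.
Implicit Types (p q r U W : {mfun T >-> R}) (f g : T -> R).

Definition integrable_under p f :=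
  mu.-integrable setT (fun x => (f x * p x)%:E).

Lemma mfun_meas p : measurable_fun setT p.
Proof. exact: measurable_funP. Qed.

Lemma measurable_weight p f : measurable_fun setT f ->
  measurable_fun setT (fun x => (f x * p x)%:E).
Proof.
move=> mf; apply/measurable_EFinP.
by apply: measurable_funM => //; exact: mfun_meas.
Qed.

Lemma integrable_underP p f : measurable_fun setT f ->
  integrable_under p f <-> expect mu p f \is a fin_num.
Proof.
move=> mf; rewrite -integral_fin_num_abs//; last first.
  by apply/measurable_EFinP; exact: measurable_weight.
split=> [/integrableP[]//|h]; apply/integrableP; split=> //.
exact: measurable_weight.
Qed.

(** The dominating function may refer to another density; changes of measure
between the members of a family are all instances of this comparison. *)
Lemma integrable_under_le p r f g : measurable_fun setT f ->
  integrable_under r g ->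
  {ae mu, forall x, `|f x * p x| <= g x * r x} -> integrable_under p f.
Proof.
move=> mf /integrableP[mg gi] fg; apply/integrableP; split.
  exact: measurable_weight.
apply: le_lt_trans gi; apply: ae_ge0_le_integral => //.
- by apply: measurableT_comp => //; exact: measurable_weight.
- exact: measurableT_comp.
apply: filterS fg => x fg _ /=; rewrite lee_fin.
by rewrite (le_trans fg)// ler_norm.
Qed.

Lemma expect_ae p r f g : measurable_fun setT f -> measurable_fun setT g ->
  {ae mu, forall x, f x * p x = g x * r x} -> expect mu p f = expect mu r g.
Proof.
move=> mf mg fg; apply: ae_eq_integral => //; do 1?exact: measurable_weight.
by apply: filterS fg => x -> _.
Qed.

Lemma expect_ge0 p f : measurable_fun setT f ->
  {ae mu, forall x, 0 <= f x * p x} -> (0 <= expect mu p f)%E.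
Proof.
move=> mf f0; rewrite (_ : expect mu p f = \int[mu]_x `|(f x * p x)%:E|)%E.
  exact: integral_ge0.
apply: ae_eq_integral => //; first exact: measurable_weight.
  by apply: measurableT_comp => //; exact: measurable_weight.
by apply: filterS f0 => x f0 _; rewrite gee0_abs.
Qed.

Lemma integrable_under_lty p f : measurable_fun setT f ->
  {ae mu, forall x, 0 <= f x * p x} ->
  integrable_under p f <-> (expect mu p f < +oo)%E.
Proof.
move=> mf f0; rewrite integrable_underP// ge0_fin_numE//; exact: expect_ge0.
Qed.

Lemma integrable_underD p f g : integrable_under p f -> integrable_under p g ->
  integrable_under p (fun x => f x + g x).
Proof.
move=> hf hg; apply: eq_integrable (integrableD measurableT hf hg) => // x _.
by rewrite mulrDl EFinD.
Qed.

Lemma integrable_underZ p f k : integrable_under p f ->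
  integrable_under p (fun x => k * f x).
Proof.
move=> hf; apply: eq_integrable (integrableZl measurableT k hf) => // x _.
by rewrite -EFinM mulrA.
Qed.

Lemma expectD p f g : integrable_under p f -> integrable_under p g ->
  expect mu p (fun x => f x + g x) = (expect mu p f + expect mu p g)%E.
Proof.
move=> hf hg; rewrite /expect -integralD//.
by apply: eq_integral => x _; rewrite mulrDl EFinD.
Qed.

Lemma expectZ p f k : integrable_under p f ->
  expect mu p (fun x => k * f x) = (k%:E * expect mu p f)%E.
Proof.
move=> hf; rewrite /expect -integralZl//.
by apply: eq_integral => x _; rewrite -EFinM mulrA.
Qed.

Lemma expect_le p r f g : integrable_under p f -> integrable_under r g ->
  {ae mu, forall x, f x * p x <= g x * r x} ->
  (expect mu p f <= expect mu r g)%E.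
Proof.
move=> hf hg fg.
have hB := integrableB measurableT hg hf.
have : (0 <= \int[mu]_x ((g x * r x)%:E - (f x * p x)%:E))%E.
  rewrite (_ : (\int[mu]_x _ =
                \int[mu]_x `|(g x * r x)%:E - (f x * p x)%:E|)%E).
    exact: integral_ge0.
  apply: ae_eq_integral => //; first exact: measurable_int hB.
    by apply: measurableT_comp => //; exact: measurable_int hB.
  by apply: filterS fg => x fg _; rewrite gee0_abs// -EFinB lee_fin subr_ge0.
rewrite integralB// -/(expect mu r g) -/(expect mu p f) sube_ge0//.
by apply/orP; left; exact: (integrable_fin_num measurableT hf).
Qed.

Lemma expect_abs_le p f : measurable_fun setT f ->
  {ae mu, forall x, 0 <= p x} ->
  (`|expect mu p f| <= expect mu p (fun x => `|f x|%R))%E.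
Proof.
move=> mf p0.
apply: le_trans (le_abse_integral mu measurableT (measurable_weight p f mf)) _.
rewrite le_eqVlt; apply/orP; left; apply/eqP.
apply: ae_eq_integral => //.
- by apply: measurableT_comp => //; exact: measurable_weight.
- by apply: measurable_weight; exact: measurableT_comp.
by apply: filterS p0 => x p0 _ /=; rewrite normrM (ger0_norm p0).
Qed.

Lemma density_ge0 p : density mu p -> {ae mu, forall x, 0 <= p x}.
Proof. by case. Qed.

Lemma pos_density_gt0 p : pos_density mu p -> {ae mu, forall x, 0 < p x}.
Proof. by case. Qed.

Lemma pos_density_ge0 p : pos_density mu p -> {ae mu, forall x, 0 <= p x}.
Proof. by case=> -[]. Qed.

Lemma expect_cst p c : density mu p -> expect mu p (fun=> c) = c%:E.
Proof.
move=> [p0 p1]; rewrite /expect.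
under eq_integral do rewrite EFinM.
rewrite integralZl// ?p1 ?mule1//.
apply/integrableP; split; first by apply/measurable_EFinP; exact: mfun_meas.
rewrite integral_fin_num_abs ?p1//; exact: mfun_meas.
Qed.

Lemma integrable_under_cst p c : density mu p -> integrable_under p (fun=> c).
Proof. by move=> dp; apply/integrable_underP; rewrite ?expect_cst. Qed.

Definition mk_mfun f (mf : measurable_fun setT f) : {mfun T >-> R} :=
  HB.pack f (isMeasurableFun.Build _ _ _ _ f mf).

Lemma expR_integrable_le p (t a : R) U : {ae mu, forall x, 0 <= p x} ->
  `|t| <= a -> integrable_under p (fun x => expR (a * `|U x|)) ->
  integrable_under p (fun x => expR (t * U x)).
Proof.
move=> p0 ta h; apply: integrable_under_le h _.
  apply: measurableT_comp => //.
  by apply: measurable_funM => //; exact: mfun_meas.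
apply: filterS p0 => x p0; rewrite ger0_norm ?mulr_ge0 ?expR_ge0//.
rewrite ler_wpM2r// ler_expR (le_trans (ler_norm _))// normrM.
by rewrite ler_wpM2r.
Qed.

Lemma measurable_expnorm (a : R) U :
  measurable_fun setT (fun x => expR (a * `|U x|)).
Proof.
apply: measurableT_comp => //; apply: measurable_funM => //.
by apply: measurableT_comp => //; exact: mfun_meas.
Qed.

Lemma measurable_Phi_scale (a : R) U :
  measurable_fun setT (fun x => Phi (a * U x)).
Proof.
apply: measurableT_comp; first exact: measurable_Phi.
by apply: measurable_funM => //; exact: mfun_meas.
Qed.

Lemma ae_weight_ge0 p f : {ae mu, forall x, 0 <= p x} -> (forall x, 0 <= f x) ->
  {ae mu, forall x, 0 <= f x * p x}.
Proof. by move=> p0 f0; apply: filterS p0 => x p0; rewrite mulr_ge0. Qed.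

(** [Phi (a U)] and [exp (a |U|)] bound each other up to constants, which are
integrable since a density has mass [1]. The exponential form is the one that
composes well with products of densities. *)
Lemma integrable_under_PhiP p (a : R) U : density mu p -> 0 <= a ->
  integrable_under p (fun x => Phi (a * U x)) <->
  integrable_under p (fun x => expR (a * `|U x|)).
Proof.
move=> dp a0; have p0 := density_ge0 p dp; split => h.
  apply: (integrable_under_le p p _ (fun x => 2 * Phi (a * U x) + 2)).
  - exact: measurable_expnorm.
  - apply: integrable_underD; first exact: integrable_underZ.
    exact: integrable_under_cst.
  apply: filterS p0 => x p0; rewrite ger0_norm ?mulr_ge0 ?expR_ge0//.
  by rewrite ler_wpM2r// (le_trans _ (expR_norm_le _))// normrM (ger0_norm a0).
apply: integrable_under_le h _; first exact: measurable_Phi_scale.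
apply: filterS p0 => x p0; rewrite ger0_norm ?mulr_ge0 ?Phi_ge0//.
by rewrite ler_wpM2r// (le_trans (Phi_le _))// normrM (ger0_norm a0).
Qed.

(** * The Orlicz space and its gauge *)

Lemma orliczP p U : density mu p ->
  orlicz mu p U <->
  exists2 a : R, 0 < a & integrable_under p (fun x => expR (a * `|U x|)).
Proof.
move=> dp; have H (a : R) : 0 < a ->
    (expect mu p (fun x => Phi (a * U x)%R) < +oo)%E <->
    integrable_under p (fun x => expR (a * `|U x|)).
  move=> a0; rewrite -integrable_under_PhiP// ?ltW//.
  rewrite integrable_under_lty//; last first.
    by apply: ae_weight_ge0; [exact: density_ge0|move=> x; exact: Phi_ge0].
  exact: measurable_Phi_scale.
by split=> -[a a0 /(H _ a0) ?]; exists a.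
Qed.

Lemma orlicz_integrable p U : density mu p -> orlicz mu p U ->
  integrable_under p U.
Proof.
move=> dp /(orliczP _ _ dp)[a a0 h]; have p0 := density_ge0 p dp.
apply: (integrable_under_le _ _ _ _ (mfun_meas U)
  (integrable_underZ p _ a^-1 h)).
apply: filterS p0 => x p0; rewrite normrM (ger0_norm p0) ler_wpM2r//.
rewrite ler_pdivlMl//; apply: le_trans (expR_ge1Dx _); lra.
Qed.

Lemma orlicz_lin p (c : R) U W : density mu p ->
  orlicz mu p U -> orlicz mu p W ->
  orlicz mu p (c *: U + W).
Proof.
move=> dp /(orliczP _ _ dp)[a a0 hU] /(orliczP _ _ dp)[b b0 hW].
have p0 := density_ge0 p dp; apply/orliczP => //.
have c0 : 0 < `|c| + 1 by rewrite ltr_wpDl.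
(* Half of each exponent is kept for either summand; adding [1] to [`|c|]
   covers the case [c = 0]. *)
pose e := Num.min (a / 2 / (`|c| + 1)) (b / 2).
have e0 : 0 < e by rewrite lt_min !divr_gt0.
exists e => //; apply: integrable_under_le (integrable_underD _ _ _ hU hW) _.
  exact: measurable_expnorm.
apply: filterS p0 => x p0; rewrite ger0_norm ?mulr_ge0 ?expR_ge0// ler_wpM2r//.
have h01 : 0 <= (2^-1 : R) <= 1 by apply/andP; split; lra.
apply: le_trans (expR_conv_le _ _ _ h01); rewrite ler_expR.
have ea : e * `|c| <= a / 2.
  apply: (@le_trans _ _ (e * (`|c| + 1))).
    by rewrite ler_wpM2l ?(ltW e0)//; lra.
  by rewrite -ler_pdivlMr// ge_min lexx.
have eb : e <= b / 2 by rewrite ge_min lexx orbT.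
have nrm : `|(c *: U + W) x| <= `|c| * `|U x| + `|W x|.
  by rewrite (le_trans (ler_normD _ _))// normrM.
have := normr_ge0 (U x); have := normr_ge0 (W x) => W0 U0.
apply: (le_trans (ler_wpM2l (ltW e0) nrm)).
have := ler_wpM2r U0 ea; have := ler_wpM2r W0 eb; lra.
Qed.

Lemma orlicz_bounded p U (M : R) : density mu p ->
  (forall x, `|U x| <= M) -> orlicz mu p U.
Proof.
move=> dp UM; apply/orliczP => //; exists 1 => //.
apply: (integrable_under_le _ _ _ _ (measurable_expnorm 1 U)
  (integrable_under_cst p (expR M) dp)).
apply: filterS (density_ge0 p dp) => x p0.
by rewrite ger0_norm ?mulr_ge0 ?expR_ge0// ler_wpM2r// ler_expR mul1r.
Qed.

Lemma mfun_linE (c : R) U W x : (c *: U + W) x = c * U x + W x.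
Proof. by []. Qed.

Lemma expect_lin p (c : R) U W : integrable_under p U -> integrable_under p W ->
  integrable_under p (c *: U + W) /\
  expect mu p (c *: U + W) = (c%:E * expect mu p U + expect mu p W)%E.
Proof.
move=> hU hW; have hcU := integrable_underZ p U c hU.
split; first exact: (integrable_underD _ _ _ hcU hW).
by rewrite -expectZ//; exact: (expectD _ _ _ hcU hW).
Qed.

Lemma centered_lin p (c : R) U W : density mu p ->
  centered mu p U -> centered mu p W -> centered mu p (c *: U + W).
Proof.
move=> dp [oU eU] [oW eW]; split; first exact: orlicz_lin.
have [_ ->] := expect_lin p c U W (orlicz_integrable _ _ dp oU)
  (orlicz_integrable _ _ dp oW).
by rewrite eU eW mule0 adde0.
Qed.

(** An expectation that diverges is infinite, so a null one converges. *)
Lemma expect0_integrable p U : expect mu p U = 0%E -> integrable_under p U.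
Proof. by move=> h; apply/integrable_underP; [exact: mfun_meas|rewrite h]. Qed.

(** Rays from the origin are continuous for the gauge: an interior point [U] can
be prolonged to [(1 + t) *: U] inside the domain of the cumulant. *)
Lemma orlicz_norm_small p U (e : R) : density mu p -> orlicz mu p U -> 0 < e ->
  exists2 t : R, 0 < t & (orlicz_norm mu p (t *: U) < e%:E)%E.
Proof.
move=> dp [a a0 ha] e0; have p0 := density_ge0 p dp.
have PE : integrable_under p (fun x => Phi (a * U x)).
  apply/integrable_under_lty => //; first exact: measurable_Phi_scale.
  by apply: ae_weight_ge0 => // x; exact: Phi_ge0.
set M := fine (expect mu p (fun x => Phi (a * U x))).
have ME : expect mu p (fun x => Phi (a * U x)) = M%:E.
  rewrite fineK//; apply/integrable_underP => //.
  exact: measurable_Phi_scale.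
have M0 : 0 <= M.
  rewrite -lee_fin -ME; apply: expect_ge0; first exact: measurable_Phi_scale.
  by apply: ae_weight_ge0 => // x; exact: Phi_ge0.
have M10 : 0 < M + 1 by rewrite ltr_wpDl.
(* By convexity [E_p[Phi (s a U)] <= s M <= 1], and the factor [e / 2] in the
   choice of [t] makes the gauge at most [e / 2]. *)
pose s := (M + 1)^-1; have s0 : 0 < s by rewrite invr_gt0.
have s1 : 0 <= s <= 1 by rewrite ltW//= invf_le1// lerDr.
have sM : s * M <= 1 by rewrite mulrC ler_pdivrMr// mul1r; lra.
exists (e / 2 * s * a); first by rewrite !mulr_gt0// divr_gt0.
apply: (@le_lt_trans _ _ (e / 2)%:E); last by rewrite lte_fin; lra.
apply: ereal_inf_lbound; exists (e / 2) => //; split; first by rewrite divr_gt0.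
rewrite (_ : (fun x => _) = (fun x => Phi (s * (a * U x)))); last first.
  apply/funext => x; congr Phi; rewrite -[X in _ * X]/(e / 2 * s * a * U x).
  by field; rewrite gt_eqF.
have sPE := integrable_underZ p _ s PE.
have mP : measurable_fun setT (fun x => Phi (s * (a * U x))).
  by under eq_fun do rewrite mulrA; exact: measurable_Phi_scale.
have PEs : integrable_under p (fun x => Phi (s * (a * U x))).
  apply: (integrable_under_le _ _ _ _ mP sPE); apply: filterS p0 => x p0.
  by rewrite ger0_norm ?mulr_ge0 ?Phi_ge0// ler_wpM2r// Phi_scale.
apply: (@le_trans _ _ (expect mu p (fun x => s * Phi (a * U x)))).
  apply: expect_le => //; apply: filterS p0 => x p0.
  by rewrite ler_wpM2r// Phi_scale.
by rewrite expectZ// ME -EFinM lee_fin.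
Qed.

(** The bound [E_p[Phi (U / k)] <= 1] in exponential form; [4 = 2 * 1 + 2] comes
from [expR_norm_le]. *)
Lemma orlicz_norm_lt p U (e : R) : density mu p ->
  (orlicz_norm mu p U < e%:E)%E -> exists k : R, [/\ 0 < k, k < e,
    integrable_under p (fun x => expR (k^-1 * `|U x|)) &
    (expect mu p (fun x => expR (k^-1 * `|U x|)) <= 4%:E)%E].
Proof.
move=> dp /ereal_inf_lt[_ [k [k0 hk] <-] ke]; exists k.
have p0 := density_ge0 p dp; have ki0 : 0 <= k^-1 by rewrite invr_ge0 ltW.
have PE : integrable_under p (fun x => Phi (k^-1 * U x)).
  apply/integrable_under_lty; first exact: measurable_Phi_scale.
    by apply: ae_weight_ge0 => // x; exact: Phi_ge0.
  exact: (le_lt_trans hk (ltry _)).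
have EE : integrable_under p (fun x => expR (k^-1 * `|U x|)).
  by apply/integrable_under_PhiP.
split=> //; have P2 := integrable_underZ p _ 2 PE.
apply: (@le_trans _ _ (expect mu p (fun x => 2 * Phi (k^-1 * U x) + 2))).
  apply: expect_le => //.
    by apply: integrable_underD => //; exact: integrable_under_cst.
  apply: filterS p0 => x p0.
  by rewrite ler_wpM2r// (le_trans _ (expR_norm_le _))// normrM (ger0_norm ki0).
rewrite expectD//; last exact: integrable_under_cst.
rewrite expectZ// expect_cst//.
apply: (@le_trans _ _ (2%:E * 1 + 2%:E)%E).
  by rewrite leeD2r// lee_wpmul2l// lee_fin.
by rewrite mule1 -EFinD lee_fin; lra.
Qed.

End densities.

(** * Linked densities *)

Section links.
Context {d : measure_display} {T : measurableType d} {R : realType}.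
Variable mu : {measure set T -> \bar R}.
Implicit Types (p q r U W : {mfun T >-> R}) (f g : T -> R).
Local Notation integrable_under := (integrable_under mu).

Definition log_ratio p r x := ln (r x) - ln (p x).

(** Finiteness of the integral of [p^(1-s) r^s], with the integrand written
relatively to [p]. *)
Definition moment_finite p r (s : R) :=
  integrable_under p (fun x => expR (s * log_ratio p r x)).

(** The condition that [r / p] is in [L^(1+e)(p)] and [p / r] in [L^(1+e)(r)],
the second half being rewritten as a negative moment under [p]. *)
Definition linked p r := exists2 e : R, 0 < e &
  moment_finite p r (- e) /\ moment_finite p r (1 + e).

Lemma measurable_log_ratio p r : measurable_fun setT (log_ratio p r).
Proof.
by apply: measurable_funB; apply: measurableT_comp => //; exact: mfun_meas.
Qed.

Lemma measurable_expR_lin (s : R) f : measurable_fun setT f ->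
  measurable_fun setT (fun x => expR (s * f x)).
Proof. by move=> mf; apply: measurableT_comp => //; exact: measurable_funM. Qed.

Lemma moment_finite_between p r (a b s : R) : {ae mu, forall x, 0 <= p x} ->
  a <= s -> s <= b -> moment_finite p r a -> moment_finite p r b ->
  moment_finite p r s.
Proof.
move=> p0 as_ sb ha hb.
apply: (integrable_under_le _ _ _ _ _ _ (integrable_underD _ _ _ _ ha hb)).
  by apply: measurable_expR_lin; exact: measurable_log_ratio.
apply: filterS p0 => x p0.
rewrite ger0_norm ?mulr_ge0 ?expR_ge0// ler_wpM2r//.
set L := log_ratio p r x.
have [L0|L0] := leP 0 L.
  by apply: ler_wpDl (expR_ge0 _) _; rewrite ler_expR ler_wpM2r.
apply: ler_wpDr (expR_ge0 _) _; rewrite ler_expR.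
by rewrite (ler_nM2r L0).
Qed.

Lemma linked_le p r (e e' : R) : {ae mu, forall x, 0 <= p x} ->
  0 < e' -> e' <= e -> moment_finite p r (- e) -> moment_finite p r (1 + e) ->
  moment_finite p r (- e') /\ moment_finite p r (1 + e').
Proof.
move=> p0 e0 ee h1 h2; split; apply: moment_finite_between h1 h2 => //; lra.
Qed.

(** Both sides are the integral of [p^(1-s) r^s]. *)
Lemma moment_finite_sym p r (s : R) :
  {ae mu, forall x, 0 < p x} -> {ae mu, forall x, 0 < r x} ->
  moment_finite p r s -> moment_finite r p (1 - s).
Proof.
move=> p0 r0 h; apply: integrable_under_le h _.
  by apply: measurable_expR_lin; exact: measurable_log_ratio.
apply: filterS2 p0 r0 => x p0 r0.
rewrite ger0_norm ?mulr_ge0 ?expR_ge0 ?(ltW r0)// /log_ratio.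
rewrite -[X in _ * X <= _]lnK ?posrE// -[X in _ <= _ * X]lnK ?posrE//.
by rewrite -!expRD ler_expR; lra.
Qed.

Lemma linked_sym p r :
  {ae mu, forall x, 0 < p x} -> {ae mu, forall x, 0 < r x} ->
  linked p r -> linked r p.
Proof.
move=> p0 r0 [e e0 [h1 h2]]; exists e => //; split.
  by have := moment_finite_sym _ _ _ p0 r0 h2; rewrite opprD addrA subrr add0r.
by have := moment_finite_sym _ _ _ p0 r0 h1; rewrite opprK.
Qed.

(** With [X = ln r - ln q] and [Y = ln q - ln p], the quantity to integrate
under [q] is [exp ((1 + b) X + b Y)]. Hoelder's inequality with weights
[(1 + a) / (1 + 2 a)] and [a / (1 + 2 a)] bounds it by [exp ((1 + a) X)] and
[exp (a Y)]; [b = a^2 / (1 + 2 a)] is the value for which both exponents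
match. *)
Lemma moment_finite_trans p q r (a : R) :
  {ae mu, forall x, 0 < p x} -> {ae mu, forall x, 0 < q x} ->
  {ae mu, forall x, 0 < r x} -> 0 < a ->
  moment_finite q r (1 + a) -> moment_finite q p (- a) ->
  moment_finite p r (1 + a ^+ 2 / (1 + 2 * a)).
Proof.
move=> p0 q0 r0 a0 h1 h2.
apply: (integrable_under_le _ _ _ _ _ _ (integrable_underD _ _ _ _ h1 h2)).
  by apply: measurable_expR_lin; exact: measurable_log_ratio.
apply: filterS3 p0 q0 r0 => x p0 q0 r0.
rewrite ger0_norm ?mulr_ge0 ?expR_ge0 ?(ltW p0)// /log_ratio.
rewrite -[X in _ * X <= _]lnK ?posrE// -[X in _ <= _ * X]lnK ?posrE//.
rewrite [leRHS]mulrDl -!expRD.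
have b0 : 0 < 1 + 2 * a by lra.
have s01 : 0 <= (1 + a) / (1 + 2 * a) <= 1.
  by rewrite ler_pdivrMr// ler_pdivlMr//; apply/andP; split; lra.
apply: le_trans (expR_conv_le _ _ _ s01); rewrite ler_expR.
rewrite le_eqVlt; apply/orP; left; apply/eqP; field.
by rewrite gt_eqF.
Qed.

Lemma linked_trans p q r :
  {ae mu, forall x, 0 < p x} -> {ae mu, forall x, 0 < q x} ->
  {ae mu, forall x, 0 < r x} -> linked p q -> linked q r -> linked p r.
Proof.
move=> p0 q0 r0 /(linked_sym _ _ p0 q0)[e1 e10 [h1 h2]] [e2 e20 [h3 h4]].
have q0' : {ae mu, forall x, 0 <= q x} by apply: filterS q0 => x /ltW.
pose a := Num.min e1 e2.
have a0 : 0 < a by rewrite lt_min e10.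
have ae1 : a <= e1 by rewrite ge_min lexx.
have ae2 : a <= e2 by rewrite ge_min lexx orbT.
have [h5 h6] := linked_le _ _ e1 a q0' a0 ae1 h1 h2.
have [h7 h8] := linked_le _ _ e2 a q0' a0 ae2 h3 h4.
exists (a ^+ 2 / (1 + 2 * a)); first by rewrite divr_gt0 ?exprn_gt0//; lra.
split; last exact: moment_finite_trans h8 h5.
have := moment_finite_sym _ _ _ r0 p0
  (moment_finite_trans _ _ _ _ r0 q0 p0 a0 h6 h7).
by rewrite opprD addrA subrr add0r.
Qed.

Definition log_ratio_mfun p r := mk_mfun _ (measurable_log_ratio p r).

Lemma linked_orlicz p r : density mu p -> linked p r ->
  orlicz mu p (log_ratio_mfun p r).
Proof.
move=> dp [e e0 [h1 h2]]; apply/orliczP => //; exists e => //.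
have p0 := density_ge0 mu p dp.
have h3 : moment_finite p r e by apply: moment_finite_between h1 h2 => //; lra.
apply: (integrable_under_le _ _ _ _ _ _ (integrable_underD _ _ _ _ h1 h3)).
  exact: measurable_expnorm.
apply: filterS p0 => x p0; rewrite ger0_norm ?mulr_ge0 ?expR_ge0// ler_wpM2r//=.
exact: expR_norm_sum.
Qed.

(** Otherwise [p] would vanish almost everywhere, against [int p = 1]. This
keeps the logarithm in the cumulant away from [- oo]. *)
Lemma expect_expR_gt0 p U : pos_density mu p ->
  (0 < expect mu p (fun x => expR (U x)))%E.
Proof.
move=> [dp p0]; have p0' := density_ge0 mu p dp.
have mU : measurable_fun setT (fun x => expR (U x)).
  by apply: measurableT_comp => //; exact: mfun_meas.
rewrite lt0e; apply/andP; split; last first.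
  by apply: expect_ge0 => //; apply: ae_weight_ge0 => // x; exact: expR_ge0.
apply/eqP => h.
have H : (\int[mu]_x `|(expR (U x) * p x)%:E| = 0)%E.
  rewrite -h; apply: ae_eq_integral => //.
  - by apply: measurableT_comp => //; exact: measurable_weight.
  - exact: measurable_weight.
  apply: filterS p0' => x p0' _.
  by rewrite gee0_abs// lee_fin mulr_ge0 ?expR_ge0.
have [_] := dp; move: H => /(ae_eq_integral_abs mu measurableT).
move=> /(_ (measurable_weight _ _ mU)) H.
rewrite (ae_eq_integral (cst 0%E))//; last first.
  apply: filterS H => x /(_ Logic.I) /= [] /eqP.
  by rewrite mulf_eq0 expR_eq0/= => /eqP -> _.
  by apply/measurable_EFinP; exact: mfun_meas.
by rewrite integral0 => /esym /eqP; rewrite onee_eq0.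
Qed.

Lemma cumulantE p U : pos_density mu p ->
  integrable_under p (fun x => expR (U x)) ->
  expect mu p (fun x => expR (U x)) = (expR (fine (cumulant mu p U)))%:E.
Proof.
move=> dp h; have e0 := expect_expR_gt0 p U dp.
have : expect mu p (fun x => expR (U x)) \is a fin_num.
  apply/integrable_underP => //.
  by apply: measurableT_comp => //; exact: mfun_meas.
rewrite /cumulant; move: e0; case: (expect _ _ _) => // z.
by rewrite lte_fin => z0 _; rewrite lne_EFin//= lnK.
Qed.

Lemma cumulant_ltyP p U : pos_density mu p ->
  (cumulant mu p U < +oo)%E <-> integrable_under p (fun x => expR (U x)).
Proof.
move=> dp; rewrite integrable_under_lty; last 2 first.
- by apply: measurableT_comp => //; exact: mfun_meas.
- by apply: ae_weight_ge0; [exact: pos_density_ge0|move=> x; exact: expR_ge0].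
rewrite /cumulant; have := expect_expR_gt0 p U dp.
case: (expect _ _ _) => // z z0; rewrite lne_EFin//.
by split => _; exact: ltry.
Qed.

End links.

(** * The maximal exponential family as the class of linked densities *)

Section maxexps.
Context {d : measure_display} {T : measurableType d} {R : realType}.
Variable mu : {measure set T -> \bar R}.
Implicit Types (p q r U W : {mfun T >-> R}) (f g : T -> R).
Local Notation integrable_under := (integrable_under mu).
Local Notation moment_finite := (moment_finite mu).
Local Notation linked := (linked mu).

Lemma measurable_expR_mfun U : measurable_fun setT (fun x => expR (U x)).
Proof. by apply: measurableT_comp => //; exact: mfun_meas. Qed.

(** Interiority of [U] yields the moment of order [1 + t], membership in the
Orlicz space the moment of order [- a]. *)
Lemma maxexp_linked p r : pos_density mu p -> maxexp mu p r ->
  pos_density mu r /\ linked p r.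
Proof.
move=> pp [U [cU [_ KU] [e e0 he]] rE]; have [dp p0] := pp.
have p0' := pos_density_ge0 mu p pp.
have hU := (cumulant_ltyP mu p U pp).1 KU.
set K := fine (cumulant mu p U) in rE.
have rE' : {ae mu, forall x, r x = expR (U x - K) * p x}.
  by apply: filterS rE => x; exact.
have r0 : {ae mu, forall x, 0 < r x}.
  by apply: filterS2 rE' p0 => x -> p0; rewrite mulr_gt0// expR_gt0.
have rden : density mu r.
  split; first by apply: filterS r0 => x /ltW.
  rewrite (_ : (\int[mu]_x _)%E =
               expect mu p (fun x => expR (- K) * expR (U x))).
    rewrite expectZ// (cumulantE mu p U pp hU) -EFinM -expRD addrC subrr.
    by rewrite expR0.
  apply: ae_eq_integral => //.
    by apply/measurable_EFinP; exact: mfun_meas.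
    apply: measurable_weight; apply: measurable_funM => //.
    exact: measurable_expR_mfun.
  by apply: filterS rE' => x -> _; rewrite -expRD addrC.
split=> //.
have lrE : {ae mu, forall x, log_ratio p r x = U x - K}.
  apply: filterS2 rE' p0 => x + p0; rewrite /log_ratio => ->.
  by rewrite lnM ?posrE ?expR_gt0// expRK addrK.
have mom s :
    integrable_under p (fun x => expR (s * U x)) -> moment_finite p r s.
  move=> h.
  apply: integrable_under_le (integrable_underZ mu p _ (expR (- (s * K))) h) _.
    by apply: measurable_expR_lin; exact: measurable_log_ratio.
  apply: filterS2 lrE p0' => x -> p0x.
  rewrite ger0_norm ?mulr_ge0 ?expR_ge0// ler_wpM2r// -expRD ler_expR; lra.
have [a a0 ha] := (orliczP mu p U dp).1 cU.1.
have [t t0 ht] := orlicz_norm_small mu p U e dp cU.1 e0.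
have hW : (cumulant mu p (t *: U + U)%R < +oo)%E.
  by apply: (he _ (centered_lin mu p t U U dp cU cU) _).2; rewrite addrK.
have m1 : moment_finite p r (1 + t).
  apply: mom; apply: integrable_under_le ((cumulant_ltyP mu p _ pp).1 hW) _.
    by apply: measurable_expR_lin; exact: mfun_meas.
  apply: filterS p0' => x p0x.
  rewrite ger0_norm ?mulr_ge0 ?expR_ge0// ler_wpM2r// ler_expR mfun_linE; lra.
have m2 : moment_finite p r (- a).
  apply: mom; apply: expR_integrable_le ha => //.
  by rewrite normrN gtr0_norm.
pose b := Num.min t a.
have b0 : 0 < b by rewrite lt_min t0.
have bt : b <= t by rewrite ge_min lexx.
have ba : b <= a by rewrite ge_min lexx orbT.
by exists b => //; split; apply: moment_finite_between m2 m1 => //; lra.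
Qed.

(** The exponent is [U = L - m] with [m = E_p[L]], for which [K_p(U) = - m]. If
[W] is within [e / (1 + e)] of [U], then [exp W = exp U exp (W - U)] is
integrable by Hoelder's inequality with exponents [1 + e] and [(1 + e) / e]. *)
Lemma linked_maxexp p r : pos_density mu p -> pos_density mu r ->
  linked p r -> maxexp mu p r.
Proof.
move=> pp pr lpr; have [dp p0] := pp; have [dr r0] := pr.
have p0' := pos_density_ge0 mu p pp.
have oL := linked_orlicz mu p r dp lpr.
set L := log_ratio_mfun p r in oL.
have EL := orlicz_integrable mu p L dp oL.
set m := fine (expect mu p L).
have mE : expect mu p L = m%:E.
  by rewrite fineK//; apply/integrable_underP => //; exact: mfun_meas.
pose C : {mfun T >-> R} := mk_mfun (cst (- m)) (measurable_cst (- m)).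
have oC : orlicz mu p C.
  by apply: (orlicz_bounded mu p C `|- m|) => // x; exact: lexx.
pose U := 1 *: L + C.
have UE x : U x = log_ratio p r x - m by rewrite /U mfun_linE mul1r.
have cU : centered mu p U.
  split; first exact: orlicz_lin.
  have [_ ->] := expect_lin mu p 1 L C EL (orlicz_integrable _ _ _ dp oC).
  by rewrite mE mul1e (expect_cst mu p _ dp) -EFinD subrr.
have eU : expect mu p (fun x => expR (U x)) = (expR (- m))%:E.
  rewrite -(expect_cst mu r _ dr); apply: expect_ae.
  - exact: measurable_expR_mfun.
  - exact: measurable_cst.
  apply: filterS2 p0 r0 => x p0 r0; rewrite UE /log_ratio.
  rewrite -[X in _ * X = _]lnK ?posrE// -[X in _ = _ * X]lnK ?posrE//.
  by rewrite -!expRD; congr expR; lra.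
have hU : integrable_under p (fun x => expR (U x)).
  by apply/integrable_underP; [exact: measurable_expR_mfun|rewrite eU].
have KE : fine (cumulant mu p U) = - m.
  by move: eU; rewrite (cumulantE mu p U pp hU) => -[] /expR_inj.
exists U; last first.
  rewrite KE; apply: filterS2 p0 r0 => x p0 r0 _; rewrite UE opprK subrK.
  by rewrite /log_ratio expRB !lnK ?posrE// divfK// gt_eqF.
have [e e0 [h1 h2]] := lpr.
have e10 : 0 < 1 + e by lra.
split=> //; first by split=> //; apply/cumulant_ltyP.
exists (e / (1 + e)); first by rewrite divr_gt0.
move=> W cW /(orlicz_norm_lt mu p (W - U) _ dp)[k [k0 ke hk _]].
split=> //; apply/cumulant_ltyP => //.
apply: (integrable_under_le _ _ _ _ _ _ (integrable_underD _ _ _ _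
  (integrable_underZ _ _ _ (expR (- (1 + e) * m)) h2) hk)).
  exact: measurable_expR_mfun.
apply: filterS p0' => x p0x.
rewrite ger0_norm ?mulr_ge0 ?expR_ge0// ler_wpM2r//.
have s01 : 0 <= (1 + e)^-1 <= 1 by rewrite invr_ge0 ltW//= invf_le1//; lra.
rewrite -expRD; apply: le_trans (expR_conv_le _ _ _ s01); rewrite ler_expR.
have -> : W x = U x + (W - U) x by rewrite mfunB /= addrC subrK.
rewrite UE; set l := log_ratio p r x; set D := (W - U) x.
have -> : (1 + e)^-1 * (- (1 + e) * m + (1 + e) * l) = l - m.
  by field; rewrite gt_eqF.
rewrite lerD2l; apply: le_trans (ler_norm _) _.
have -> : 1 - (1 + e)^-1 = e / (1 + e) by field; rewrite gt_eqF.
rewrite mulrA -[leLHS]mul1r ler_wpM2r// ler_pdivlMr// mul1r; exact: ltW.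
Qed.

Lemma maxexpP p r : pos_density mu p ->
  maxexp mu p r <-> pos_density mu r /\ linked p r.
Proof.
by move=> pp; split=> [|[]]; [exact: maxexp_linked|exact: linked_maxexp].
Qed.

Lemma maxexp_eq p q : pos_density mu p -> maxexp mu p q ->
  maxexp mu q = maxexp mu p.
Proof.
move=> pp /(maxexp_linked _ _ pp)[pq pq_].
have p0 := pos_density_gt0 mu p pp; have q0 := pos_density_gt0 mu q pq.
apply/seteqP; split=> r; rewrite !maxexpP// => -[pr lr]; split=> //;
  have r0 := pos_density_gt0 mu r pr.
  exact: linked_trans pq_ lr.
by apply: linked_trans lr => //; exact: linked_sym.
Qed.

(** Continuity of [U |-> E_r[U]] for the gauge at [p]: from [y <= exp (c y) / c]
with [c = e / (1 + e)], Hoelder's inequality gives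
[c (|U| / k) (r / p) <= exp ((1 + e) L) + exp (|U| / k)], and both terms on the
right have bounded expectation under [p] when [k] bounds the gauge of [U]. *)
Lemma linked_expect_bound p r : pos_density mu p -> pos_density mu r ->
  linked p r -> exists2 C : R, 0 < C & forall (k : R) U, 0 < k ->
    integrable_under p (fun x => expR (k^-1 * `|U x|)) ->
    integrable_under r U /\
    ((expect mu p (fun x => expR (k^-1 * `|U x|)) <= 4%:E)%E ->
     (expect mu r (fun x => `|U x|%R) <= (C * k)%:E)%E).
Proof.
move=> pp pr [e e0 [_ h]]; have [dp p0] := pp; have [dr r0] := pr.
have p0' := pos_density_ge0 mu p pp; have r0' := pos_density_ge0 mu r pr.
pose M := fine (expect mu p (fun x => expR ((1 + e) * log_ratio p r x))).
have mM : measurable_fun setT (fun x => expR ((1 + e) * log_ratio p r x)).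
  by apply: measurable_expR_lin; exact: measurable_log_ratio.
have ME : expect mu p (fun x => expR ((1 + e) * log_ratio p r x)) = M%:E.
  by rewrite fineK//; apply/integrable_underP.
have M0 : 0 <= M.
  rewrite -lee_fin -ME; apply: expect_ge0 => //.
  by apply: ae_weight_ge0 => // x; exact: expR_ge0.
have e10 : 0 < 1 + e by lra.
pose c := e / (1 + e); have c0 : 0 < c by rewrite divr_gt0.
have cE : 1 - (1 + e)^-1 = c by rewrite /c; field; rewrite gt_eqF.
exists (c^-1 * (4 + M)); first by rewrite mulr_gt0 ?invr_gt0//; lra.
move=> k U k0 hk; pose f x := expR (k^-1 * `|U x|).
pose g x := expR ((1 + e) * log_ratio p r x).
have hfg := integrable_underZ mu p _ (k * c^-1)
  (integrable_underD _ _ _ _ h hk).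
have mU : measurable_fun setT (fun x => `|U x|).
  by apply: measurableT_comp => //; exact: mfun_meas.
have s01 : 0 <= (1 + e)^-1 <= 1 by rewrite invr_ge0 ltW//= invf_le1//; lra.
have key : {ae mu, forall x, `|U x| * r x <= k * c^-1 * (g x + f x) * p x}.
  apply: filterS2 p0 r0 => x p0 r0; rewrite /f /g; set y := `|U x|.
  have y0 : 0 <= y by exact: normr_ge0.
  have := expR_conv_le _ ((1 + e) * log_ratio p r x) (k^-1 * y) s01.
  rewrite cE mulrA mulVf ?mul1r ?gt_eqF// expRD.
  have -> : expR (log_ratio p r x) = r x / p x.
    by rewrite /log_ratio expRB !lnK ?posrE.
  move=> H.
  have yE : y <= k * c^-1 * expR (c * (k^-1 * y)).
    rewrite -[leLHS](_ : k * c^-1 * (c * (k^-1 * y)) = y); last first.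
      by field; rewrite !gt_eqF.
    rewrite ler_wpM2l ?mulr_ge0 ?invr_ge0 ?(ltW k0) ?(ltW c0)//.
    by apply: le_trans (expR_ge1Dx _); rewrite lerDr.
  apply: (le_trans (ler_wpM2r (ltW r0) yE)).
  rewrite -[leLHS]mulrA -[leRHS]mulrA.
  rewrite ler_wpM2l ?mulr_ge0 ?invr_ge0 ?(ltW k0) ?(ltW c0)//.
  by rewrite -ler_pdivrMr// -[leLHS]mulrA mulrC.
have rU : integrable_under r U.
  apply: integrable_under_le hfg _; first exact: mfun_meas.
  by apply: filterS2 r0' key => x r0x; rewrite normrM (ger0_norm r0x).
split=> // h4.
have rU' : integrable_under r (fun x => `|U x|).
  apply: integrable_under_le hfg _ => //.
  by apply: filterS2 r0' key => x r0x; rewrite normrM normr_id (ger0_norm r0x).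
apply: (@le_trans _ _ (expect mu p (fun x => k * c^-1 * (g x + f x)))).
  exact: expect_le.
rewrite expectZ; last exact: integrable_underD.
rewrite expectD// ME.
apply: (@le_trans _ _ ((k * c^-1)%:E * (M%:E + 4%:E))%E).
  rewrite lee_wpmul2l//; last by rewrite leeD2l.
  by rewrite lee_fin mulr_ge0 ?invr_ge0 ?ltW.
rewrite -EFinD -EFinM lee_fin le_eqVlt; apply/orP; left; apply/eqP.
ring.
Qed.

Lemma linked_integrable p r U : pos_density mu p -> pos_density mu r ->
  linked p r -> orlicz mu p U -> integrable_under r U.
Proof.
move=> pp pr lpr /(orliczP mu p U pp.1)[a a0 ha].
have [C C0 H] := linked_expect_bound p r pp pr lpr.
by apply: (H a^-1 U _ _).1; rewrite ?invr_gt0// invrK.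
Qed.

(** [|E_r[U]| = |E_r[W - U]| <= C ||W - U||], which can be made arbitrarily
small. *)
Lemma expect_closed p r U : pos_density mu p -> maxexp mu p r ->
  orlicz mu p U ->
  (forall e : R, 0 < e -> exists2 W, orlicz mu p W /\ expect mu r W = 0%E &
     (orlicz_norm mu p (W - U)%R < e%:E)%E) ->
  expect mu r U = 0%E.
Proof.
move=> pp /(maxexp_linked _ _ pp)[pr lpr] oU happ.
have [C C0 H] := linked_expect_bound p r pp pr lpr.
have rU := linked_integrable p r U pp pr lpr oU.
have r0 := pos_density_ge0 mu r pr.
have mU := mfun_meas U.
set y := expect mu r U.
have yfin : y \is a fin_num by apply/integrable_underP.
suff : (`|y| <= 0)%E.
  by move=> y0; apply/eqP; rewrite -abse_eq0 eq_le y0 abse_ge0.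
apply/lee_addgt0Pr => e e0; rewrite add0e.
have eC0 : 0 < e / C by rewrite divr_gt0.
have [W [oW eW] hn] := happ _ eC0.
have [k [k0 ke hk h4]] := orlicz_norm_lt mu p (W - U) _ pp.1 hn.
have [rWU hb] := H k (W - U) k0 hk.
have rW := linked_integrable p r W pp pr lpr oW.
have yE : expect mu r (W - U) = (- y)%E.
  have [_] := expect_lin mu r (-1) U W rU rW.
  by rewrite scaleN1r addrC eW adde0 mulN1e.
rewrite -abseN -yE.
apply: le_trans (expect_abs_le mu r _ (mfun_meas (W - U)) r0) _.
apply: le_trans (hb h4) _; rewrite lee_fin mulrC -ler_pdivlMr//.
exact: ltW.
Qed.

End maxexps.

(** * Mixtures of densities *)

Section mixtures.
Context {d : measure_display} {T : measurableType d} {R : realType}.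
Variable mu : {measure set T -> \bar R}.
Implicit Types (p r U W : {mfun T >-> R}) (f g : T -> R).
Local Notation integrable_under := (integrable_under mu).
Local Notation moment_finite := (moment_finite mu).
Local Notation linked := (linked mu).

Section families.
Variables (n : nat) (q : 'I_n.+1 -> {mfun T >-> R}).

Lemma mfun_combE (a : 'I_n.+1 -> R) x :
  (\sum_i a i *: q i : {mfun T >-> R}) x = \sum_i a i * q i x.
Proof. by rewrite mfun_sum. Qed.

Lemma expect_comb (a : 'I_n.+1 -> R) r f : measurable_fun setT f ->
  r = (\sum_i a i *: q i : {mfun T >-> R}) %[ae mu] ->
  (forall i, integrable_under (q i) f) ->
  expect mu r f = (\sum_i (a i)%:E * expect mu (q i) f)%E.
Proof.
move=> mf rE hf; rewrite (_ : (\sum_i _)%E =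
    \int[mu]_x (\sum_i (a i)%:E * (f x * q i x)%:E))%E; last first.
  rewrite integral_sum//; last first.
    by move=> i; exact: (integrableZl measurableT (a i) (hf i)).
  by apply: eq_bigr => i _; rewrite integralZl//; exact: hf.
apply: ae_eq_integral => //; first exact: measurable_weight.
  apply: emeasurable_sum => i; apply: measurable_funeM.
  exact: measurable_weight.
apply: filterS rE => x /(_ Logic.I) -> _; rewrite mfun_combE mulr_sumr -sumEFin.
by apply: eq_bigr => i _; rewrite -EFinM mulrCA.
Qed.

Lemma ae_forall_ord (P : 'I_n.+1 -> T -> Prop) :
  (forall i, {ae mu, forall x, P i x}) -> {ae mu, forall x, forall i, P i x}.
Proof.
move=> H; exact: filter_forall.
Qed.

Lemma integrable_under_sum p (f : 'I_n.+1 -> T -> R) :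
  (forall i, integrable_under p (f i)) ->
  integrable_under p (fun x => \sum_i f i x).
Proof.
move=> hf; have H := @integrable_sum _ _ _ mu _ measurableT _
  (index_enum 'I_n.+1) xpredT _ (fun i _ => hf i).
apply: eq_integrable H => // x _.
by rewrite sumEFin mulr_suml.
Qed.

Lemma mixture_pos_density r : (forall i, pos_density mu (q i)) ->
  mixture mu q r -> pos_density mu r.
Proof.
move=> hq [th [th0 th1 rE]].
have r0 : {ae mu, forall x, 0 < r x}.
  have q0 := ae_forall_ord _ (fun i => pos_density_gt0 mu (q i) (hq i)).
  apply: filterS2 rE q0 => x /(_ Logic.I) -> q0; rewrite mfun_combE.
  have [[i hi] _] := convex_between n th (q ^~ x) th0 th1.
  exact: lt_le_trans (q0 i) hi.
split=> //; split; first by apply: filterS r0 => x /ltW.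
rewrite (_ : \int[mu]_x _ = expect mu r (fun=> 1%R))%E; last first.
  by apply: eq_integral => x _; rewrite mul1r.
rewrite (expect_comb th r _ (measurable_cst _) rE
  (fun i => integrable_under_cst mu _ 1 (hq i).1)).
under eq_bigr do rewrite (expect_cst mu _ 1 (hq _).1) mule1.
by rewrite sumEFin th1.
Qed.

(** A power [r^s] is monotone in [r], increasing or decreasing with the sign of
[s]; since some component lies above the mixture and some lies below it, the
integrand is at most the sum of those of the components. *)
Lemma moment_finite_mixture p r (s : R) : {ae mu, forall x, 0 <= p x} ->
  (forall i, pos_density mu (q i)) -> mixture mu q r ->
  (forall i, moment_finite p (q i) s) -> moment_finite p r s.
Proof.
move=> p0 hq mr hs.
have r0 := pos_density_gt0 mu r (mixture_pos_density r hq mr).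
have [th [th0 th1 rE]] := mr.
have q0 := ae_forall_ord _ (fun i => pos_density_gt0 mu (q i) (hq i)).
apply: integrable_under_le (integrable_under_sum p _ hs) _.
  by apply: measurable_expR_lin; exact: measurable_log_ratio.
have q0r0 : {ae mu, forall x, 0 < r x /\ forall i, 0 < q i x}.
  by apply: filterS2 r0 q0 => x.
apply: filterS3 p0 q0r0 rE => x {}p0 [{}r0 {}q0] /(_ Logic.I) {}rE.
rewrite ger0_norm ?mulr_ge0 ?expR_ge0// ler_wpM2r//.
suff [i hi] : exists i, s * log_ratio p r x <= s * log_ratio p (q i) x.
  rewrite (bigD1 i)//=; apply: ler_wpDr; last by rewrite ler_expR.
  by apply: sumr_ge0 => j _; exact: expR_ge0.
have [[i hi] [j hj]] := convex_between n th (q ^~ x) th0 th1.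
rewrite mfun_combE in rE; rewrite -rE in hi hj.
have [s0|s0] := leP 0 s.
  by exists j; rewrite ler_wpM2l// lerD2r ler_ln ?posrE.
by exists i; rewrite (ler_nM2l s0) lerD2r ler_ln ?posrE.
Qed.

Lemma linked_uniform p : {ae mu, forall x, 0 <= p x} ->
  (forall i, linked p (q i)) ->
  exists2 e : R, 0 < e & forall i, moment_finite p (q i) (- e) /\
                                   moment_finite p (q i) (1 + e).
Proof.
move=> p0 hl.
have /choice[e eP] : forall i, exists e : R, 0 < e /\
  (moment_finite p (q i) (- e) /\ moment_finite p (q i) (1 + e)).
  by move=> i; have [e e0 h] := hl i; exists e.
have [k _ kP] := @arg_minP _ R _ ord0 xpredT e isT.
exists (e k) => [|i]; first exact: (eP k).1.
have [h1 h2] := (eP i).2.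
exact: (linked_le mu _ _ _ _ p0 (eP k).1 (kP i isT) h1 h2).
Qed.

Lemma mixture_linked p r : {ae mu, forall x, 0 <= p x} ->
  (forall i, pos_density mu (q i)) -> (forall i, linked p (q i)) ->
  mixture mu q r -> linked p r.
Proof.
move=> p0 hq hl mr; have [e e0 he] := linked_uniform p p0 hl.
by exists e => //; split; apply: moment_finite_mixture => // i; have [] := he i.
Qed.

End families.

Lemma ae_eq_of_indicators r s : integrable_under r (cst 1) ->
  (forall A, measurable A -> expect mu r \1_A = expect mu s \1_A) ->
  r = s %[ae mu].
Proof.
move=> hr H.
have iE (u : {mfun T >-> R}) A : measurable A ->
    (\int[mu]_(x in A) (u x)%:E = expect mu u \1_A)%E.
  move=> mA; rewrite integral_mkcond; apply: eq_integral => x _.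
  by rewrite patchE indicE; case: ifP => xA; rewrite ?mul1r ?mul0r.
have /filterS : {ae mu, forall x, setT x -> (r x)%:E = (s x)%:E}.
  apply: integral_ae_eq => //.
  - by apply: eq_integrable hr => // x _; rewrite mul1r.
  - by apply/measurable_EFinP; exact: mfun_meas.
  by move=> A _ mA; rewrite !iE// H.
by apply=> x /[apply] -[].
Qed.

End mixtures.

(** * Mixtures inside a maximal exponential family *)

Section mixture_of_maxexp.
Context {d : measure_display} {T : measurableType d} {R : realType}.
Variable mu : {measure set T -> \bar R}.
Variables (n : nat) (q : 'I_n.+1 -> {mfun T >-> R}).
Implicit Types (p r U W : {mfun T >-> R}).
Local Notation integrable_under := (integrable_under mu).

Lemma mixture_maxexp p : pos_density mu p -> (forall i, maxexp mu p (q i)) ->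
  mixture mu q `<=` maxexp mu p.
Proof.
move=> pp hq r mr; have hq' i := maxexp_linked mu p (q i) pp (hq i).
apply: linked_maxexp => //.
  by apply: mixture_pos_density mr => i; exact: (hq' i).1.
apply: mixture_linked mr; first exact: pos_density_ge0.
  by move=> i; exact: (hq' i).1.
by move=> i; exact: (hq' i).2.
Qed.

Lemma mixture_expect0 r U : mixture mu q r ->
  (forall i, expect mu (q i) U = 0%E) ->
  expect mu r U = 0%E.
Proof.
move=> [th [_ _ rE]] U0.
rewrite (expect_comb mu n q th r U (mfun_meas U) rE).
  by rewrite big1// => i _; rewrite U0 mule0.
by move=> i; exact: expect0_integrable.
Qed.

Lemma annihilator1_linear p : density mu p ->
  linear_subspace (annihilator1 mu p q).
Proof.
move=> dp.
have e0 r : expect mu r (0 : {mfun T >-> R}) = 0%E.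
  by rewrite /expect; under eq_integral do rewrite mul0r; rewrite integral0.
split.
  split=> //; split=> //; apply: (orlicz_bounded mu p _ 0) => // x.
  by rewrite normr0.
move=> a U W [cU U0] [cW W0]; split; first exact: centered_lin.
move=> j; have [_ ->] := expect_lin mu (q j) a U W
  (expect0_integrable _ _ _ (U0 j)) (expect0_integrable _ _ _ (W0 j)).
by rewrite U0 W0 mule0 adde0.
Qed.

Lemma annihilator1_closed p : pos_density mu p ->
  (forall i, maxexp mu p (q i)) ->
  closed_in_centered mu p (annihilator1 mu p q).
Proof.
move=> pp hq; split=> [U []//|U cU happ]; split=> // j.
apply: (expect_closed mu p (q j) U pp (hq j) cU.1) => e e0.
by have [W [cW W0] hW] := happ e e0; exists W => //; split=> //; exact: cW.1.
Qed.

Lemma mixture_sub_mixture_closed p : pos_density mu p ->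
  (forall i, maxexp mu p (q i)) ->
  mixture mu q `<=` mixture_closed mu p (annihilator1 mu p q).
Proof.
move=> pp hq r mr; split; first exact: mixture_maxexp.
by move=> U [_ U0]; exact: mixture_expect0.
Qed.

(** The functionals are restricted to bounded functions: these are integrable
under all densities, lie in all Orlicz spaces, and separate densities. *)
Lemma annihilator1_comb p r : pos_density mu p ->
  (forall i, maxexp mu p (q i)) -> mixture mu q p ->
  mixture_closed mu p (annihilator1 mu p q) r ->
  exists2 alpha : 'I_n.+1 -> R, \sum_i alpha i = 1 &
    r = (\sum_i alpha i *: q i : {mfun T >-> R}) %[ae mu].
Proof.
move=> pp hq mp [rp r0]; have dp := pp.1.
have [[dr _] _] := maxexp_linked mu p r pp rp.
have dq i : density mu (q i) by have [[]] := maxexp_linked mu p (q i) pp (hq i).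
pose B : set {mfun T >-> R} := [set U | exists M : R, forall x, `|U x| <= M].
have BP (a : R) (U W : {mfun T >-> R}) : B U -> B W -> B (a *: U + W).
  move=> [M UM] [N WN]; exists (`|a| * M + N) => x; rewrite mfun_linE.
  by rewrite (le_trans (ler_normD _ _))// lerD// normrM ler_wpM2l.
have Bint s U : density mu s -> B U -> integrable_under s U.
  move=> ds [M UM]; apply: orlicz_integrable => //.
  exact: (orlicz_bounded _ _ _ M).
have fin s U : density mu s -> B U -> expect mu s U \is a fin_num.
  by move=> ds BU; apply/integrable_underP; [exact: mfun_meas|exact: Bint].
have lin s : density mu s -> lin_on B (fun U => fine (expect mu s U)).
  move=> ds a U W BU BW.
  have [_ ->] := expect_lin mu s a U W (Bint _ _ ds BU) (Bint _ _ ds BW).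
  by rewrite fineD ?fineM ?fin_numM// fin.
have [x Bx qx|alpha alphaE] := functional_span B n.+1
    (fun i U => fine (expect mu (q i) U)) _ BP (fun i => lin _ (dq i))
    (lin _ dr).
- have qx0 i : expect mu (q i) x = 0%E by rewrite -[LHS]fineK ?fin// qx.
  rewrite r0//; split=> //; split; last exact: mixture_expect0.
  by have [M xM] := Bx; exact: (orlicz_bounded _ _ _ M).
have aE U : B U -> expect mu r U = (\sum_i (alpha i)%:E * expect mu (q i) U)%E.
  move=> BU; rewrite -[LHS]fineK ?fin// alphaE// -sumEFin.
  by apply: eq_bigr => i _; rewrite EFinM fineK ?fin.
have cE s (c : R) : density mu s -> expect mu s (cst c) = c%:E.
  exact: expect_cst.
exists alpha.
  have B1 : B (cst 1) by exists 1 => x; rewrite normr1.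
  apply: EFin_inj; rewrite -(cE r 1 dr) -sumEFin (aE (cst 1) B1).
  by apply: eq_bigr => i _; rewrite (cE _ _ (dq i)) mule1.
apply: ae_eq_of_indicators; first exact: integrable_under_cst.
move=> A mA; pose U : {mfun T >-> R} := indic_mfun A mA.
have BU : B U.
  exists 1 => x; rewrite (_ : U x = \1_A x)// indicE.
  by case: (_ \in _); rewrite ?normr1 ?normr0.
rewrite (aE U BU); symmetry; apply: expect_comb.
- exact: measurable_indic.
- exact: aeW.
by move=> i; exact: (Bint _ U).
Qed.

Lemma mixture_closed_sub_mixture p : pos_density mu p ->
  (forall i, maxexp mu p (q i)) -> mixture mu q p ->
  (forall alpha : 'I_n.+1 -> R, \sum_i alpha i = 1 ->
    pos_density mu (\sum_i alpha i *: q i) -> forall i, 0 <= alpha i) ->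
  mixture_closed mu p (annihilator1 mu p q) `<=` mixture mu q.
Proof.
move=> pp hq mp hpos r mr.
have [alpha a1 rE] := annihilator1_comb p r pp hq mp mr.
have [[[rge0 r1] rgt0] _] := maxexp_linked mu p r pp mr.1.
exists alpha; split=> //; apply: hpos => //; split; last first.
  by apply: filterS2 rE rgt0 => x /(_ Logic.I) ->.
split; first by apply: filterS2 rE rge0 => x /(_ Logic.I) ->.
rewrite -r1; apply: ae_eq_integral => //.
- by apply/measurable_EFinP; exact: mfun_meas.
- by apply/measurable_EFinP; exact: mfun_meas.
by apply: filterS rE => x /(_ Logic.I) -> _.
Qed.

End mixture_of_maxexp.

Theorem proposition5p3 (d : measure_display) (T : measurableType d)
    (R : realType) (mu : {measure set T -> \bar R}) (n : nat)
    (q : 'I_n.+1 -> {mfun T >-> R}) (hq : forall i, density mu (q i)) :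
  [/\ forall p : {mfun T >-> R}, pos_density mu p ->
        (forall i, maxexp mu p (q i)) ->
        mixture mu q `<=` maxexp mu p /\
        (forall p' : {mfun T >-> R}, mixture mu q p' ->
          [/\ pos_density mu p', maxexp mu p' = maxexp mu p &
              mixture mu q `<=` maxexp mu p']),
      forall p : {mfun T >-> R}, pos_density mu p ->
        (forall i, maxexp mu p (q i)) ->
        [/\ linear_subspace (annihilator1 mu p q),
            closed_in_centered mu p (annihilator1 mu p q) &
            mixture mu q `<=` mixture_closed mu p (annihilator1 mu p q)]
    & forall p : {mfun T >-> R}, pos_density mu p ->
        (forall i, maxexp mu p (q i)) ->
        mixture mu q p ->
        (forall alpha : 'I_n.+1 -> R, \sum_i alpha i = 1 ->
          pos_density mu (\sum_i alpha i *: q i) ->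
          forall i, 0 <= alpha i) ->
        mixture mu q = mixture_closed mu p (annihilator1 mu p q)].
Proof.
split=> p pp hE.
- split; first exact: mixture_maxexp.
  move=> p' mp'; have rp' := mixture_maxexp mu n q p pp hE _ mp'.
  split; first exact: (maxexp_linked mu p p' pp rp').1.
    exact: maxexp_eq.
  by rewrite (maxexp_eq mu p p')//; exact: mixture_maxexp.
- split; first exact: (annihilator1_linear _ _ _ _ pp.1).
    exact: annihilator1_closed.
  exact: mixture_sub_mixture_closed.
move=> mp hpos; apply/seteqP; split; first exact: mixture_sub_mixture_closed.
exact: mixture_closed_sub_mixture.
Qed.
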